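(* Let $M$ be a smooth connected manifold with a linear connection $\nabla$ (a connection on $TM$) with torsion $T$. For every $1$-form $\theta\in\bigwedge^1(M)$, $$T_\theta=d\theta+\Xi_\theta,\qquad\text{equivalently}\qquad T_\theta=d\theta-\nabla\theta\wedge I,$$ where $T_\theta$ and $\Xi_\theta$ are the $2$-forms given by $T_\theta(X,Y)=\theta(T(X,Y))$ and $\Xi_\theta(X,Y)=(\nabla_Y\theta)(X)-(\nabla_X\theta)(Y)=-(\nabla\theta\wedge I)(X,Y)$ for $X,Y\in\mathfrak{X}(M)$.
   Context: $\mathfrak{X}(M)$ denotes smooth vector fields on $M$. The torsion is $T(X,Y)=\nabla_XY-\nabla_YX-[X,Y]$. The connection acts on $1$-forms by $(\nabla_X\theta)(Y)=X(\theta(Y))-\theta(\nabla_XY)$. $I$ is the identity endomorphism of $\mathfrak{X}(M)$, and $(\nabla\theta\wedge I)(X,Y):=(\nabla_X\theta)(Y)-(\nabla_Y\theta)(X)$. The exterior derivative is normalized by $d\theta(X,Y)=X(\theta(Y))-Y(\theta(X))-\theta([X,Y])$. *)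

(* Defs.v *)
From HB Require Import structures.
From mathcomp Require Import all_boot all_order all_algebra.
From mathcomp Require Import mathcomp_extra boolp classical_sets functions.
From mathcomp Require Import reals topology normedtype derive ring.

Set Implicit Arguments.
Unset Strict Implicit.
Unset Printing Implicit Defensive.

Import Order.TTheory GRing.Theory Num.Theory.
Import numFieldNormedType.Exports.

Local Open Scope classical_set_scope.
Local Open Scope ring_scope.

Section Ck.
Variables (R : realType) (n : nat).
Implicit Types (U : set 'rV[R]_n) (f g : 'rV[R]_n -> R).

(* Only meant for open U: continuity and partial derivatives are taken in the
   ambient space R^n. *)
Fixpoint Ck (k : nat) U f : Prop :=
  (forall x, U x -> {for x, continuous f}) /\
  if k is k'.+1 then
    forall i : 'I_n, (forall x, U x -> derivable f x (delta_mx 0 i)) /\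
                     Ck k' U ('D_(delta_mx 0 i) f)
  else True.

Definition Cinfty U f : Prop := forall k, Ck k U f.

Lemma CkW k U f : Ck k.+1 U f -> Ck k U f.
Proof.
elim: k f => [|k IH] f; first by case.
move=> [fc fD]; split=> // i.
by have [di Di] := fD i; split=> //; exact: IH.
Qed.

Lemma near_eq_on U f g x : open U -> (forall y, U y -> f y = g y) -> U x ->
  \forall y \near x, f y = g y.
Proof.
by move=> oU fg Ux; have : nbhs x U by [exact: open_nbhs_nbhs]; exact: filterS.
Qed.

Lemma continuous_eq_on U f g : open U -> (forall x, U x -> f x = g x) ->
  (forall x, U x -> {for x, continuous f}) ->
  forall x, U x -> {for x, continuous g}.
Proof.
move=> oU fg fc x Ux; rewrite /prop_for /continuous_at -(fg _ Ux).
by apply: cvg_trans (fc x Ux); apply: (@near_eq_cvg _ _ (nbhs x)); exact: near_eq_on oU fg Ux.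
Qed.

Lemma Ck_eq k U f g : open U -> (forall x, U x -> f x = g x) ->
  Ck k U f -> Ck k U g.
Proof.
move=> oU; elim: k f g => [|k IH] f g fg [fc fD].
  by split=> //; exact: continuous_eq_on oU fg fc.
split=> [|i]; first exact: continuous_eq_on oU fg fc.
have [di Di] := fD i; split=> [x Ux|].
  by apply: near_eq_derivable (di x Ux); exact: near_eq_on oU fg Ux.
by apply: IH Di => x Ux; apply: near_eq_derive; exact: near_eq_on oU fg Ux.
Qed.

Lemma Ck_cst k U (a : R) : Ck k U (cst a).
Proof.
elim: k a => [|k IH] a; (split; first by move=> x _; exact: cst_continuous) => // i.
split; first by move=> x _; exact: derivable_cst.
rewrite (_ : 'D_(delta_mx 0 i) (cst a) = cst 0); first exact: IH.
by apply/funext => x; rewrite derive_cst.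
Qed.

Lemma Ck_add k U f g : open U -> Ck k U f -> Ck k U g -> Ck k U (f + g).
Proof.
move=> oU; elim: k f g => [|k IH] f g [fc fD] [gc gD].
all: have fgc x : U x -> {for x, continuous (f + g)}.
1,3: by move=> Ux; exact: continuousD (fc x Ux) (gc x Ux).
all: split=> // i.
have [dfi Dfi] := fD i; have [dgi Dgi] := gD i; split.
  by move=> x Ux; apply: derivableD; [exact: dfi|exact: dgi].
apply: (Ck_eq oU _ (IH _ _ Dfi Dgi)) => x Ux.
by rewrite deriveD; [|exact: dfi|exact: dgi].
Qed.

Lemma Ck_mul k U f g : open U -> Ck k U f -> Ck k U g -> Ck k U (f * g).
Proof.
move=> oU; elim: k f g => [|k IH] f g fk gk.
all: have [[fc fD] [gc gD]] := (fk, gk).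
all: have fgc x : U x -> {for x, continuous (f * g)}.
1,3: by move=> Ux; exact: continuousM (fc x Ux) (gc x Ux).
all: split=> // i.
have [dfi Dfi] := fD i; have [dgi Dgi] := gD i; split.
  by move=> x Ux; apply: derivableM; [exact: dfi|exact: dgi].
have H := Ck_add oU (IH _ _ (CkW fk) Dgi) (IH _ _ (CkW gk) Dfi).
apply: (Ck_eq oU _ H) => x Ux.
by rewrite deriveM; [|exact: dfi|exact: dgi].
Qed.

End Ck.

Section Manifold.
Variables (R : realType) (n : nat).

(* The values of [chart_map] off [chart_dom] and of [chart_inv] off the image
   are irrelevant. *)
Record chart (M : topologicalType) := Chart {
  chart_dom : set M ;
  chart_map :> M -> 'rV[R]_n ;
  chart_inv : 'rV[R]_n -> M ;
  chart_open_dom : open chart_dom ;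
  chart_open_img : open (chart_map @` chart_dom) ;
  chart_mapK : forall p, chart_dom p -> chart_inv (chart_map p) = p ;
  chart_map_continuous : {within chart_dom, continuous chart_map} ;
  chart_inv_continuous :
    {within chart_map @` chart_dom, continuous chart_inv} }.

Definition chart_img (M : topologicalType) (phi : chart M) : set 'rV[R]_n :=
  phi @` chart_dom phi.

Definition smooth_transition (M : topologicalType) (phi psi : chart M) : Prop :=
  forall j : 'I_n,
    Cinfty (phi @` (chart_dom phi `&` chart_dom psi))
           (fun x => psi (chart_inv phi x) 0 j).

(* The atlas is not required to be maximal: every atlas lies in a unique
   maximal one, and both have the same smooth functions. *)
Record smoothManifold := SmoothManifold {
  manifold_space :> topologicalType ;
  atlas : set (chart manifold_space) ;
  manifold_hausdorff : hausdorff_space manifold_space ;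
  manifold_second_countable : @second_countable manifold_space ;
  atlas_cover : forall p : manifold_space,
    exists2 phi, atlas phi & chart_dom phi p ;
  atlas_compatible : forall phi psi, atlas phi -> atlas psi ->
    smooth_transition phi psi }.

End Manifold.

Section SmoothFunctions.
Variables (R : realType) (n : nat) (M : smoothManifold R n).

Definition smooth (f : M -> R) : Prop :=
  forall phi, atlas phi -> Cinfty (chart_img phi) (f \o chart_inv phi).

Record smoothFun := SmoothFun { sfun :> M -> R ; sfunP : smooth sfun }.

Lemma sfun_ext (f g : smoothFun) : (forall p, f p = g p) -> f = g.
Proof.
case: f g => [f fP] [g gP] /= /funext fg.
by case: g / fg gP => gP; congr SmoothFun; exact: Prop_irrelevance.
Qed.

Lemma smooth_cst (a : R) : smooth (fun=> a).
Proof. by move=> phi _ k; exact: Ck_cst. Qed.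

Lemma smooth_add (f g : M -> R) : smooth f -> smooth g ->
  smooth (fun p => f p + g p).
Proof.
move=> fP gP phi phiA k.
exact: (Ck_add (@chart_open_img _ _ _ phi) (fP _ phiA k) (gP _ phiA k)).
Qed.

Lemma smooth_mul (f g : M -> R) : smooth f -> smooth g ->
  smooth (fun p => f p * g p).
Proof.
move=> fP gP phi phiA k.
exact: (Ck_mul (@chart_open_img _ _ _ phi) (fP _ phiA k) (gP _ phiA k)).
Qed.

Lemma smooth_opp (f : M -> R) : smooth f -> smooth (fun p => - f p).
Proof.
move=> fP; rewrite (_ : (fun p => _) = (fun p => -1 * f p)).
  exact: smooth_mul (smooth_cst _) fP.
by apply/funext => p; rewrite mulN1r.
Qed.

Definition sfun_cst (a : R) : smoothFun := SmoothFun (smooth_cst a).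
Definition sfun_add (f g : smoothFun) : smoothFun :=
  SmoothFun (smooth_add (sfunP f) (sfunP g)).
Definition sfun_mul (f g : smoothFun) : smoothFun :=
  SmoothFun (smooth_mul (sfunP f) (sfunP g)).
Definition sfun_opp (f : smoothFun) : smoothFun :=
  SmoothFun (smooth_opp (sfunP f)).

HB.instance Definition _ := gen_eqMixin smoothFun.
HB.instance Definition _ := gen_choiceMixin smoothFun.

Fact sfun_addA : associative sfun_add.
Proof. by move=> f g h; apply: sfun_ext => p /=; rewrite addrA. Qed.
Fact sfun_addC : commutative sfun_add.
Proof. by move=> f g; apply: sfun_ext => p /=; rewrite addrC. Qed.
Fact sfun_add0 : left_id (sfun_cst 0) sfun_add.
Proof. by move=> f; apply: sfun_ext => p /=; rewrite add0r. Qed.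
Fact sfun_addN : left_inverse (sfun_cst 0) sfun_opp sfun_add.
Proof. by move=> f; apply: sfun_ext => p /=; rewrite addNr. Qed.

HB.instance Definition _ := GRing.isZmodule.Build smoothFun
  sfun_addA sfun_addC sfun_add0 sfun_addN.

Fact sfun_mulA : associative sfun_mul.
Proof. by move=> f g h; apply: sfun_ext => p /=; rewrite mulrA. Qed.
Fact sfun_mulC : commutative sfun_mul.
Proof. by move=> f g; apply: sfun_ext => p /=; rewrite mulrC. Qed.
Fact sfun_mul1 : left_id (sfun_cst 1) sfun_mul.
Proof. by move=> f; apply: sfun_ext => p /=; rewrite mul1r. Qed.
Fact sfun_mulDl : left_distributive sfun_mul sfun_add.
Proof. by move=> f g h; apply: sfun_ext => p /=; rewrite mulrDl. Qed.

(* C^oo(M); only a pzRing, since M may be empty. *)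
HB.instance Definition _ := GRing.Zmodule_isComPzRing.Build smoothFun
  sfun_mulA sfun_mulC sfun_mul1 sfun_mulDl.

End SmoothFunctions.

Section TangentVectors.
Variables (R : realType) (n : nat) (M : smoothManifold R n) (p : M).

(* T_pM: point derivations of C^oo(M) at p. *)
Record tangent := Tangent {
  tan :> smoothFun M -> R ;
  tan_linear : forall a f g, tan (sfun_cst M a * f + g) = a * tan f + tan g ;
  tan_leibniz : forall f g, tan (f * g) = f p * tan g + g p * tan f }.

Lemma tan_ext (v w : tangent) : (forall f, v f = w f) -> v = w.
Proof.
case: v w => [v v1 v2] [w w1 w2] /= /funext vw.
by case: w / vw w1 w2 => w1 w2; congr Tangent; exact: Prop_irrelevance.
Qed.

Program Definition tan_zero : tangent := @Tangent (fun=> 0) _ _.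
Next Obligation. by move=> a f g /=; rewrite mulr0 addr0. Qed.
Next Obligation. by move=> f g /=; rewrite !mulr0 addr0. Qed.

Program Definition tan_add (v w : tangent) : tangent :=
  @Tangent (fun f => v f + w f) _ _.
Next Obligation. by move=> v w a f g /=; rewrite !tan_linear mulrDr addrACA. Qed.
Next Obligation. by move=> v w f g /=; rewrite !tan_leibniz !mulrDr addrACA. Qed.

Program Definition tan_scale (a : R) (v : tangent) : tangent :=
  @Tangent (fun f => a * v f) _ _.
Next Obligation. by move=> a v b f g /=; rewrite tan_linear mulrDr mulrCA. Qed.
Next Obligation. by move=> a v f g /=; rewrite tan_leibniz mulrDr !(mulrCA a). Qed.

HB.instance Definition _ := gen_eqMixin tangent.
HB.instance Definition _ := gen_choiceMixin tangent.

Fact tan_addA : associative tan_add.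
Proof. by move=> u v w; apply: tan_ext => f /=; rewrite addrA. Qed.
Fact tan_addC : commutative tan_add.
Proof. by move=> u v; apply: tan_ext => f /=; rewrite addrC. Qed.
Fact tan_add0 : left_id tan_zero tan_add.
Proof. by move=> u; apply: tan_ext => f /=; rewrite add0r. Qed.
Fact tan_addN : left_inverse tan_zero (tan_scale (-1)) tan_add.
Proof. by move=> u; apply: tan_ext => f /=; rewrite mulN1r addNr. Qed.

HB.instance Definition _ := GRing.isZmodule.Build tangent
  tan_addA tan_addC tan_add0 tan_addN.

Fact tan_scaleA a b v : tan_scale a (tan_scale b v) = tan_scale (a * b) v.
Proof. by apply: tan_ext => f /=; rewrite mulrA. Qed.
Fact tan_scale1 : left_id 1 tan_scale.
Proof. by move=> v; apply: tan_ext => f /=; rewrite mul1r. Qed.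
Fact tan_scaleDr : right_distributive tan_scale +%R.
Proof. by move=> a v w; apply: tan_ext => f /=; rewrite mulrDr. Qed.
Fact tan_scaleDl v : {morph tan_scale^~ v : a b / a + b}.
Proof. by move=> a b; apply: tan_ext => f /=; rewrite mulrDl. Qed.

HB.instance Definition _ := GRing.Zmodule_isLmodule.Build R tangent
  tan_scaleA tan_scale1 tan_scaleDr tan_scaleDl.

End TangentVectors.

Section VectorFields.
Variables (R : realType) (n : nat) (M : smoothManifold R n).
Local Notation C := (smoothFun M).

(* A section p |-> X_p of TM is smooth iff p |-> X_p(f) is smooth for every
   smooth f. *)
Record vfield := VField {
  vf_at : forall p : M, tangent p ;
  vf_smooth : forall f : C, smooth (fun p => vf_at p f) }.

Definition vf_app (X : vfield) (f : C) : C := SmoothFun (vf_smooth X f).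

Coercion vf_app : vfield >-> Funclass.

Lemma vf_ext (X Y : vfield) : (forall f, X f = Y f) -> X = Y.
Proof.
move=> XY; have {}XY : vf_at X = vf_at Y.
  apply: functional_extensionality_dep => p; apply: tan_ext => f.
  exact: (congr1 (fun g : C => g p) (XY f)).
case: X Y XY => [X XP] [Y YP] /= XY.
by case: Y / XY YP => YP; congr VField; exact: Prop_irrelevance.
Qed.

Program Definition vf_zero : vfield := @VField (fun p => 0) _.
Next Obligation. by move=> f; exact: smooth_cst. Qed.

Program Definition vf_add (X Y : vfield) : vfield :=
  @VField (fun p => vf_at X p + vf_at Y p) _.
Next Obligation. by move=> X Y f; exact: smooth_add (vf_smooth X f) (vf_smooth Y f). Qed.

Program Definition vf_scale (g : C) (X : vfield) : vfield :=
  @VField (fun p => g p *: vf_at X p) _.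
Next Obligation. by move=> g X f; exact: smooth_mul (sfunP g) (vf_smooth X f). Qed.

HB.instance Definition _ := gen_eqMixin vfield.
HB.instance Definition _ := gen_choiceMixin vfield.

Fact vf_addA : associative vf_add.
Proof. by move=> X Y Z; apply: vf_ext => f; apply: sfun_ext => p /=; rewrite addrA. Qed.
Fact vf_addC : commutative vf_add.
Proof. by move=> X Y; apply: vf_ext => f; apply: sfun_ext => p /=; rewrite addrC. Qed.
Fact vf_add0 : left_id vf_zero vf_add.
Proof. by move=> X; apply: vf_ext => f; apply: sfun_ext => p /=; rewrite add0r. Qed.
Fact vf_addN : left_inverse vf_zero (vf_scale (-1)) vf_add.
Proof.
by move=> X; apply: vf_ext => f; apply: sfun_ext => p /=; rewrite mulN1r addNr.
Qed.

HB.instance Definition _ := GRing.isZmodule.Build vfield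
  vf_addA vf_addC vf_add0 vf_addN.

Fact vf_scaleA a b X : vf_scale a (vf_scale b X) = vf_scale (a * b) X.
Proof. by apply: vf_ext => f; apply: sfun_ext => p /=; rewrite mulrA. Qed.
Fact vf_scale1 : left_id 1 vf_scale.
Proof. by move=> X; apply: vf_ext => f; apply: sfun_ext => p /=; rewrite mul1r. Qed.
Fact vf_scaleDr : right_distributive vf_scale +%R.
Proof. by move=> a X Y; apply: vf_ext => f; apply: sfun_ext => p /=; rewrite mulrDr. Qed.
Fact vf_scaleDl X : {morph vf_scale^~ X : a b / a + b}.
Proof. by move=> a b; apply: vf_ext => f; apply: sfun_ext => p /=; rewrite mulrDl. Qed.

HB.instance Definition _ := GRing.Zmodule_isLmodule.Build C vfield
  vf_scaleA vf_scale1 vf_scaleDr vf_scaleDl.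

Lemma vf_linear (X : vfield) a (f g : C) :
  X (sfun_cst M a * f + g) = sfun_cst M a * X f + X g.
Proof. by apply: sfun_ext => p; exact: tan_linear. Qed.

Lemma vf_leibniz (X : vfield) (f g : C) : X (f * g) = f * X g + g * X f.
Proof. by apply: sfun_ext => p; exact: tan_leibniz. Qed.

Program Definition bracket_at (X Y : vfield) (p : M) : tangent p :=
  @Tangent _ _ _ p (fun f => vf_at X p (Y f) - vf_at Y p (X f)) _ _.
Next Obligation.
by move=> X Y p a f g /=; rewrite !vf_linear !tan_linear mulrBr opprD addrACA.
Qed.
Next Obligation.
move=> X Y p f g.
have tanD (v : tangent p) h k : v (h + k) = v h + v k.
  have := tan_linear v 1 h k; rewrite mul1r => <-; congr (v (_ + _)).
  by apply: sfun_ext => q /=; rewrite mul1r.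
rewrite /= !vf_leibniz !tanD !tan_leibniz /=.
by ring.
Qed.

Program Definition bracket (X Y : vfield) : vfield :=
  @VField (bracket_at X Y) _.
Next Obligation.
move=> X Y f.
exact: smooth_add (vf_smooth X (Y f)) (smooth_opp (vf_smooth Y (X f))).
Qed.

End VectorFields.

Section Forms.
Variables (R : realType) (n : nat) (M : smoothManifold R n).
Local Notation C := (smoothFun M).
Local Notation VF := (vfield M).

(* Differential forms are the alternating C^oo(M)-multilinear maps on vector
   fields; on a Hausdorff second countable manifold these are the smooth
   sections of the exterior powers of the cotangent bundle. *)
Definition oneForm : Type := {linear VF -> C^o}.

Definition is_twoForm (w : VF -> VF -> C) : Prop :=
  [/\ forall Y (f : C) X X', w (f *: X + X') Y = f * w X Y + w X' Y,
      forall X (f : C) Y Y', w X (f *: Y + Y') = f * w X Y + w X Y' &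
      forall X, w X X = 0].

Definition ext_d (theta : oneForm) : VF -> VF -> C := fun X Y =>
  X (theta Y) - Y (theta X) - theta (bracket X Y).

Record linearConnection := LinearConnection {
  conn :> VF -> VF -> VF ;
  conn_linear_l : forall Y (f : C) X X',
    conn (f *: X + X') Y = f *: conn X Y + conn X' Y ;
  conn_linear_r : forall X (a : R) Y Y',
    conn X (sfun_cst M a *: Y + Y') = sfun_cst M a *: conn X Y + conn X Y' ;
  conn_leibniz : forall X (f : C) Y,
    conn X (f *: Y) = X f *: Y + f *: conn X Y }.

Variable nabla : linearConnection.

Definition torsion (X Y : VF) : VF :=
  nabla X Y - nabla Y X - bracket X Y.

(* [cov theta X Y] is (nabla_X theta)(Y). *)
Definition cov (theta : oneForm) : VF -> VF -> C := fun X Y =>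
  X (theta Y) - theta (nabla X Y).

Definition wedge_id (A : VF -> VF -> C) : VF -> VF -> C := fun X Y =>
  A X Y - A Y X.

Definition torsion_form (theta : oneForm) : VF -> VF -> C := fun X Y =>
  theta (torsion X Y).

Definition Xi_form (theta : oneForm) : VF -> VF -> C := fun X Y =>
  cov theta Y X - cov theta X Y.

End Forms.

(* Main.v *)
Require Import Defs.
From mathcomp Require Import all_boot all_order all_algebra.
From mathcomp Require Import boolp classical_sets functions.
From mathcomp Require Import reals topology normedtype.
From mathcomp Require Import ring.

(** Both identities unfold to cancellations in C^oo(M), and [Xi_form] is the
    antisymmetrization of the C^oo(M)-bilinear map [cov nabla theta]. The torsion
    is alternating, so its bilinearity reduces to the first argument, where the
    term Y(f) X of nabla_Y(f X) cancels the one of [f X, Y] = f [X, Y] - Y(f) X. *)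

Import GRing.Theory.

Local Open Scope classical_set_scope.
Local Open Scope ring_scope.

Section Tensoriality.
Context {R : realType} {n : nat} {M : smoothManifold R n}.
Local Notation C := (smoothFun M).
Local Notation VF := (vfield M).
Implicit Types (X Y : VF) (f g : C).

Lemma vf_appD X f g : X (f + g) = X f + X g.
(* The constant function [sfun_cst M 1] is by definition the unit of C^oo(M). *)
Proof. by have := vf_linear X 1 f g; rewrite !mul1r. Qed.

Lemma vf_addE X Y f : (X + Y) f = X f + Y f.
Proof. exact: sfun_ext. Qed.

Lemma vf_scaleE g X f : (g *: X) f = g * X f.
Proof. exact: sfun_ext. Qed.

Lemma vf_oppE X f : (- X) f = - X f.
Proof. by apply: sfun_ext => p /=; rewrite mulN1r. Qed.

Lemma bracketE X Y f : bracket X Y f = X (Y f) - Y (X f).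
Proof. exact: sfun_ext. Qed.

Lemma bracketC X Y : bracket X Y = - bracket Y X.
Proof. by apply: vf_ext => f; rewrite vf_oppE !bracketE opprB. Qed.

Lemma bracketXX X : bracket X X = 0.
Proof.
by apply: vf_ext => f; rewrite bracketE subrr; apply: sfun_ext.
Qed.

(** Evaluated at g, the Leibniz rule for Y on [f * X g] produces the extra term [Y f * X g]. *)
Lemma bracket_linear_l f X X' Y :
  bracket (f *: X + X') Y = f *: bracket X Y - Y f *: X + bracket X' Y.
Proof.
apply: vf_ext => g.
rewrite !(vf_addE, vf_oppE, vf_scaleE, bracketE) vf_appD vf_leibniz.
by ring.
Qed.

Variable nabla : linearConnection M.

Lemma connDr X Y Y' : nabla X (Y + Y') = nabla X Y + nabla X Y'.
Proof. by have := conn_linear_r nabla X 1 Y Y'; rewrite !scale1r. Qed.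

Lemma torsionC X Y : torsion nabla X Y = - torsion nabla Y X.
Proof. by rewrite /torsion (bracketC X) opprB opprB opprK addrC. Qed.

Lemma torsion_linear_l f X X' Y :
  torsion nabla (f *: X + X') Y = f *: torsion nabla X Y + torsion nabla X' Y.
Proof.
rewrite /torsion conn_linear_l connDr conn_leibniz bracket_linear_l.
rewrite !scalerBr !opprD !opprK.
(* Terms 1, 4, 6 form [f *: torsion nabla X Y] and 2, 5, 8 form [torsion nabla X' Y]; 3 and 7 are
   the opposite copies of [Y f *: X]. *)
by rewrite [LHS](AC (2*3*3) ((1*4*6)*(2*5*8)*(3*7))) /= addNr addr0.
Qed.

Variable theta : oneForm M.

Lemma oneForm_linear f X Y : theta (f *: X + Y) = f * theta X + theta Y.
Proof. exact: linearP. Qed.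

Lemma cov_linear_l f X X' Y :
  cov nabla theta (f *: X + X') Y =
  f * cov nabla theta X Y + cov nabla theta X' Y.
Proof.
by rewrite /cov vf_addE vf_scaleE conn_linear_l oneForm_linear; ring.
Qed.

(** The term [X f * theta Y] arises both from X applied to [f * theta Y] and from the Leibniz rule
    of the connection, with opposite signs. *)
Lemma cov_linear_r f X Y Y' :
  cov nabla theta X (f *: Y + Y') =
  f * cov nabla theta X Y + cov nabla theta X Y'.
Proof.
rewrite /cov connDr conn_leibniz -addrA !oneForm_linear vf_appD vf_leibniz.
by ring.
Qed.

End Tensoriality.

Theorem corollary2p5 (R : realType) (n : nat) (M : smoothManifold R n)
    (connected_M : connected [set: M]) (nabla : linearConnection M)
    (theta : oneForm M) :
  [/\ is_twoForm (torsion_form nabla theta),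
      is_twoForm (Xi_form nabla theta),
      torsion_form nabla theta = ext_d theta + Xi_form nabla theta,
      Xi_form nabla theta = - wedge_id (cov nabla theta) &
      torsion_form nabla theta = ext_d theta - wedge_id (cov nabla theta)].
Proof.
have XiE : Xi_form nabla theta = - wedge_id (cov nabla theta).
  by apply/funext => X; apply/funext => Y; rewrite /Xi_form -opprB.
have torsionE : torsion_form nabla theta = ext_d theta + Xi_form nabla theta.
  apply/funext => X; apply/funext => Y.
  have -> : (ext_d theta + Xi_form nabla theta) X Y =
            ext_d theta X Y + Xi_form nabla theta X Y by [].
  (* The derivatives [X (theta Y)] and [Y (theta X)] cancel between [ext_d] and [Xi_form], leaving
     theta of the three torsion terms. *)
  by rewrite /torsion_form /torsion /ext_d /Xi_form /cov !linearB /=; ring.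
split=> //; last by rewrite -XiE.
- split=> [Y f X X'|X f Y Y'|X]; rewrite /torsion_form.
  + by rewrite torsion_linear_l oneForm_linear.
  + rewrite torsionC torsion_linear_l linearN oneForm_linear.
    by rewrite (torsionC _ X Y) (torsionC _ X Y') !linearN /=; ring.
  + by rewrite /torsion bracketXX !subrr linear0.
- split=> [Y f X X'|X f Y Y'|X]; rewrite /Xi_form.
  (* Each slot of [Xi_form] feeds both slots of [cov], so both linearities are used. *)
  1,2: by rewrite cov_linear_l cov_linear_r; ring.
  by rewrite subrr.
Qed.
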